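(* Let $(\mathcal{C},\mathcal{T},u,\mu)$ and $(\mathcal{D},\mathcal{S},v,\lambda)$ be categories with a flow and let $\mathcal{H}:\mathcal{C}\to\mathcal{D}$ be a colax $[0,\infty)$-equivariant functor between them. Then $\mathcal{H}$ is $1$-Lipschitz with respect to the interleaving distances, i.e. $$d_{(\mathcal{D},\mathcal{S})}(\mathcal{H}a,\mathcal{H}b)\le d_{(\mathcal{C},\mathcal{T})}(a,b)$$ for every pair of objects $a,b$ of $\mathcal{C}$.
   Context: A flow $\mathcal{T}=(\mathcal{T},u,\mu)$ on a category $\mathcal{C}$ consists of: a functor $\mathcal{T}:([0,\infty),\le)\to\mathrm{End}(\mathcal{C})$, $\varepsilon\mapsto\mathcal{T}_\varepsilon$ (where $\mathrm{End}(\mathcal{C})$ is the category of endofunctors of $\mathcal{C}$; the natural transformation assigned to $\varepsilon\le\zeta$ is written $\mathcal{T}_{(\varepsilon\le\zeta)}:\mathcal{T}_\varepsilon\Rightarrow\mathcal{T}_\zeta$); a natural transformation $u:I_{\mathcal{C}}\Rightarrow\mathcal{T}_0$; and natural transformations $\mu_{\varepsilon,\zeta}:\mathcal{T}_\varepsilon\mathcal{T}_\zeta\Rightarrow\mathcal{T}_{\varepsilon+\zeta}$ for all $\varepsilon,\zeta\ge0$; such that for all $\varepsilon,\zeta,\delta,\kappa\ge 0$: (i) $\mu_{0,\varepsilon}\circ(u\,\mathcal{T}_\varepsilon)=\mathrm{id}_{\mathcal{T}_\varepsilon}$ and $\mu_{\varepsilon,0}\circ(\mathcal{T}_\varepsilon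 u)=\mathrm{id}_{\mathcal{T}_\varepsilon}$; (ii) $\mu_{\varepsilon,\zeta+\delta}\circ(\mathcal{T}_\varepsilon\mu_{\zeta,\delta})=\mu_{\varepsilon+\zeta,\delta}\circ(\mu_{\varepsilon,\zeta}\mathcal{T}_\delta)$; (iii) $\mu_{\delta,\kappa}\circ(\mathcal{T}_{(\varepsilon\le\delta)}\mathcal{T}_{(\zeta\le\kappa)})=\mathcal{T}_{(\varepsilon+\zeta\le\delta+\kappa)}\circ\mu_{\varepsilon,\zeta}$ whenever $\varepsilon\le\delta$ and $\zeta\le\kappa$. A category with a flow is a category together with a flow on it. A weak $\varepsilon$-interleaving of objects $a,b$ of $\mathcal{C}$ is a pair of morphisms $\varphi:a\to\mathcal{T}_\varepsilon b$, $\psi:b\to\mathcal{T}_\varepsilon a$ such that $\mu_{\varepsilon,\varepsilon,a}\circ\mathcal{T}_\varepsilon\psi\circ\varphi=\mathcal{T}_{(0\le2\varepsilon),a}\circ u_a$ and $\mu_{\varepsilon,\varepsilon,b}\circ\mathcal{T}_\varepsilon\varphi\circ\psi=\mathcal{T}_{(0\le2\varepsilon),b}\circ u_b$. The interleaving distance is $d_{(\mathcal{C},\mathcal{T})}(a,b)=\inf\{\varepsilon\ge0\mid \text{there is a weak }\varepsilon\text{-interleaving of }a,b\}$, with value $\infty$ if there is none for any $\varepsilon$. A colax $[0,\infty)$-equivariant functor $(\mathcal{C},\mathcal{T},u,\mu)\to(\mathcal{D},\mathcal{S},v,\lambda)$ is a functor $\mathcal{H}:\mathcal{C}\to\mathcal{D}$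 together with, for each $\varepsilon\ge0$, a natural transformation $\eta_\varepsilon:\mathcal{H}\mathcal{T}_\varepsilon\Rightarrow\mathcal{S}_\varepsilon\mathcal{H}$ such that for all $\varepsilon,\zeta\ge0$: (a) $\eta_0\circ(\mathcal{H}u)=v\mathcal{H}$; (b) $\eta_\zeta\circ(\mathcal{H}\mathcal{T}_{(\varepsilon\le\zeta)})=(\mathcal{S}_{(\varepsilon\le\zeta)}\mathcal{H})\circ\eta_\varepsilon$ whenever $\varepsilon\le\zeta$; (c) $(\lambda_{\varepsilon,\zeta}\mathcal{H})\circ(\mathcal{S}_\varepsilon\eta_\zeta)\circ(\eta_\varepsilon\mathcal{T}_\zeta)=\eta_{\varepsilon+\zeta}\circ(\mathcal{H}\mu_{\varepsilon,\zeta})$. *)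

(* Defs.v *)
From mathcomp Require Import all_boot all_order all_algebra interval_inference.
From mathcomp Require Import all_classical all_reals ereal.

Set Implicit Arguments.
Unset Strict Implicit.
Unset Printing Implicit Defensive.

Import Order.TTheory GRing.Theory Num.Theory.

Local Open Scope ring_scope.

Declare Scope cat_scope.
Delimit Scope cat_scope with cat.
Local Open Scope cat_scope.

Record category := Category {
  obj :> Type;
  mor : obj -> obj -> Type;
  idm : forall x, mor x x;
  compm : forall x y z, mor y z -> mor x y -> mor x z;
  comp1m : forall x y (f : mor x y), compm (idm y) f = f;
  compm1 : forall x y (f : mor x y), compm f (idm x) = f;
  compmA : forall w x y z (h : mor y z) (g : mor x y) (f : mor w x),
    compm h (compm g f) = compm (compm h g) f }.

Arguments mor {c}.
Arguments idm {c}.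
Arguments compm {c x y z}.

Notation "g ∘ f" := (compm g f) (at level 40, left associativity) : cat_scope.

Record functor (C D : category) := Functor {
  fobj :> C -> D;
  fmor : forall x y, mor x y -> mor (fobj x) (fobj y);
  fmor1 : forall x, fmor (idm x) = idm (fobj x);
  fmorM : forall x y z (g : mor y z) (f : mor x y),
    fmor (g ∘ f) = fmor g ∘ fmor f }.

Arguments fmor {C D} _ [x y] _.

Definition functor_id (C : category) : functor C C.
Proof. exact: (@Functor C C id (fun x y f => f)). Defined.

Definition functor_comp (C D E : category) (G : functor D E) (F : functor C D) :
  functor C E.
Proof.
apply: (@Functor C E (fun x => G (F x)) (fun x y f => fmor G (fmor F f))).
- by move=> x; rewrite !fmor1.
- by move=> x y z g f; rewrite !fmorM.
Defined.

Record nat_trans (C D : category) (F G : functor C D) := NatTrans {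
  component :> forall x : C, mor (F x) (G x);
  naturality : forall x y (f : mor x y),
    component y ∘ fmor F f = fmor G f ∘ component x }.

Lemma nat_trans_ext (C D : category) (F G : functor C D) (s t : nat_trans F G) :
  (forall x, s x = t x) -> s = t.
Proof.
case: s t => [s ns] [t nt] /= st.
have {}st : s = t by apply: functional_extensionality_dep.
by case: t / st nt => nt; congr NatTrans; exact: Prop_irrelevance.
Qed.

Definition nat_id (C D : category) (F : functor C D) : nat_trans F F.
Proof.
apply: (@NatTrans C D F F (fun x => idm (F x))).
by move=> x y f; rewrite comp1m compm1.
Defined.

Definition nat_comp (C D : category) (F G H : functor C D)
  (t : nat_trans G H) (s : nat_trans F G) : nat_trans F H.
Proof.
apply: (@NatTrans C D F H (fun x => t x ∘ s x)).
by move=> x y f; rewrite -compmA naturality !compmA naturality.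
Defined.

Definition End_cat (C : category) : category.
Proof.
apply: (@Category (functor C C) (@nat_trans C C) (@nat_id C C)
                  (@nat_comp C C)).
- by move=> F G s; apply: nat_trans_ext => x /=; rewrite comp1m.
- by move=> F G s; apply: nat_trans_ext => x /=; rewrite compm1.
- by move=> F G H K u t s; apply: nat_trans_ext => x /=; rewrite compmA.
Defined.

Section NonnegIndices.
Context {R : realType}.
Implicit Types e z d k : {nonneg R}.

Definition nadd e z : {nonneg R} := (e%:num + z%:num)%:nng.

Lemma naddA e z d : nadd e (nadd z d) = nadd (nadd e z) d.
Proof. by apply: val_inj; rewrite /= addrA. Qed.

Lemma nadd0l e : nadd 0%:nng e = e.
Proof. by apply: val_inj; rewrite /= add0r. Qed.

Lemma nadd0r e : nadd e 0%:nng = e.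
Proof. by apply: val_inj; rewrite /= addr0. Qed.

Lemma nadd_mono e z d k : e <= d -> z <= k -> nadd e z <= nadd d k.
Proof. by move=> ed zk; rewrite -num_le /= lerD // num_le. Qed.

Lemma nneg_ge0 e : (0%:nng : {nonneg R}) <= e.
Proof. by rewrite -num_le /=. Qed.

End NonnegIndices.

(* The poset ([0,oo), <=) as a category: a morphism e -> z is a proof of
   the boolean e <= z, hence unique. *)
Definition nneg_cat (R : realType) : category.
Proof.
apply: (@Category {nonneg R} (fun e z => e <= z) (fun e => lexx e)
                  (fun e z d zd ez => le_trans ez zd));
  by move=> *; exact: bool_irrelevance.
Defined.

Definition ev_at (R : realType) (C : category)
  (T : functor (nneg_cat R) (End_cat C)) (e : {nonneg R}) : functor C C := T e.

Definition ev_le (R : realType) (C : category)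
    (T : functor (nneg_cat R) (End_cat C)) (e z : {nonneg R}) (ez : e <= z) :
  nat_trans (ev_at T e) (ev_at T z) := @fmor _ _ T e z ez.

(* Identity morphism T_e a = T_z a along an equality of indices e = z.  It is
   needed because, e.g., T_(e + (z + d)) and T_((e + z) + d) are equal but not
   convertible. *)
Definition ev_cast (R : realType) (C : category)
    (T : functor (nneg_cat R) (End_cat C)) (a : C) (e z : {nonneg R})
    (ez : e = z) : mor (ev_at T e a) (ev_at T z a) :=
  match ez in _ = z' return mor (ev_at T e a) (ev_at T z' a) with
  | erefl => idm (ev_at T e a)
  end.

(* Equations between natural transformations are stated componentwise; for
   example the component at a of T_e mu_(z,d) is fmor (T_e) (mu_(z,d) a) and
   that of mu_(e,z) T_d is mu_(e,z) (T_d a). *)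
Record flow (R : realType) (C : category) := Flow {
  flow_functor : functor (nneg_cat R) (End_cat C);
  flow_at := ev_at flow_functor;
  flow_le := ev_le flow_functor;
  flow_unit : nat_trans (functor_id C) (flow_at 0%:nng);
  flow_mul : forall e z : {nonneg R},
    nat_trans (functor_comp (flow_at e) (flow_at z)) (flow_at (nadd e z));
  flow_unitl : forall (e : {nonneg R}) (a : C),
    ev_cast flow_functor a (nadd0l e)
      ∘ (flow_mul 0%:nng e a ∘ flow_unit (flow_at e a))
    = idm (flow_at e a);
  flow_unitr : forall (e : {nonneg R}) (a : C),
    ev_cast flow_functor a (nadd0r e)
      ∘ (flow_mul e 0%:nng a ∘ fmor (flow_at e) (flow_unit a))
    = idm (flow_at e a);
  flow_mulA : forall (e z d : {nonneg R}) (a : C),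
    ev_cast flow_functor a (naddA e z d)
      ∘ (flow_mul e (nadd z d) a ∘ fmor (flow_at e) (flow_mul z d a))
    = flow_mul (nadd e z) d a ∘ flow_mul e z (flow_at d a);
  flow_mul_le : forall (e z d k : {nonneg R}) (ed : e <= d) (zk : z <= k)
      (a : C),
    flow_mul d k a
      ∘ (fmor (flow_at d) (flow_le zk a) ∘ flow_le ed (flow_at z a))
    = flow_le (nadd_mono ed zk) a ∘ flow_mul e z a }.

Definition flow_ev (R : realType) (C : category) (T : flow R C) :
  {nonneg R} -> functor C C := flow_at T.
Coercion flow_ev : flow >-> Funclass.

Section Interleaving.
Context {R : realType} {C : category} (T : flow R C).

Definition weak_interleaving (e : {nonneg R}) (a b : C)
    (phi : mor a (T e b)) (psi : mor b (T e a)) : Prop :=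
  flow_mul T e e a ∘ fmor (T e) psi ∘ phi
    = flow_le T (nneg_ge0 (nadd e e)) a ∘ flow_unit T a
  /\
  flow_mul T e e b ∘ fmor (T e) phi ∘ psi
    = flow_le T (nneg_ge0 (nadd e e)) b ∘ flow_unit T b.

Definition weakly_interleaved (e : {nonneg R}) (a b : C) : Prop :=
  exists (phi : mor a (T e b)) (psi : mor b (T e a)),
    weak_interleaving phi psi.

Definition interleaving_dist (a b : C) : \bar R :=
  ereal_inf [set (e%:num)%:E | e in [set e | weakly_interleaved e a b]]%classic.

End Interleaving.

Record colax_equivariant (R : realType) (C D : category)
    (T : flow R C) (S : flow R D) := ColaxEquivariant {
  colax_functor :> functor C D;
  colax_nt : forall e : {nonneg R},
    nat_trans (functor_comp colax_functor (T e))
              (functor_comp (S e) colax_functor);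
  colax_unit : forall a : C,
    colax_nt 0%:nng a ∘ fmor colax_functor (flow_unit T a)
    = flow_unit S (colax_functor a);
  colax_le : forall (e z : {nonneg R}) (ez : e <= z) (a : C),
    colax_nt z a ∘ fmor colax_functor (flow_le T ez a)
    = flow_le S ez (colax_functor a) ∘ colax_nt e a;
  colax_mul : forall (e z : {nonneg R}) (a : C),
    flow_mul S e z (colax_functor a) ∘ fmor (S e) (colax_nt z a)
      ∘ colax_nt e (T z a)
    = colax_nt (nadd e z) a ∘ fmor colax_functor (flow_mul T e z a) }.

(* Main.v *)
Require Import Defs.
From mathcomp Require Import all_boot all_order all_algebra.
From mathcomp Require Import all_classical all_reals ereal.

(** A weak interleaving is a pair of maps [phi : a -> T_e b] and
    [psi : b -> T_e a] that are mutually inverse in a graded Kleisli sense: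
    the composites [mu ∘ T_e psi ∘ phi] and [mu ∘ T_e phi ∘ psi] are the
    canonical maps [a -> T_(2e) a] and [b -> T_(2e) b].  The structure maps
    [eta_e] of a colax functor [H] are what is needed to turn a graded map [f]
    into the graded map [eta_e ∘ H f], and the colax axioms say that this
    preserves graded composition ([colax_map_comp]) and canonical maps
    ([colax_map_unit]).  It therefore carries weak [e]-interleavings of [a]
    and [b] to weak [e]-interleavings of [H a] and [H b], for the same [e].
    The set of interleaving parameters can only grow under [H], so its infimum
    can only decrease. *)

Local Open Scope ring_scope.
Local Open Scope cat_scope.

(** The action of [H] on the graded Kleisli maps [a -> T_e b]. *)
Definition colax_map {R : realType} {C D : category} {T : flow R C}
    {S : flow R D} (H : colax_equivariant T S) {e : {nonneg R}} {a b : C}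
    (f : mor a (T e b)) : mor (H a) (S e (H b)) :=
  colax_nt H e b ∘ fmor H f.

(** Naturality of [eta_e] at [psi] moves [H psi] past [eta_e]; what is then left
    of the two structure maps is the left-hand side of the multiplication
    axiom. *)
Lemma colax_map_comp (R : realType) (C D : category) (T : flow R C)
    (S : flow R D) (H : colax_equivariant T S) (e z : {nonneg R}) (a b c : C)
    (phi : mor a (T e b)) (psi : mor b (T z c)) :
  flow_mul S e z (H c) ∘ fmor (S e) (colax_map H psi) ∘ colax_map H phi
  = colax_map H (flow_mul T e z c ∘ fmor (T e) psi ∘ phi).
Proof.
rewrite /colax_map !fmorM !compmA -colax_mul -!compmA.
congr (_ ∘ (_ ∘ _)); rewrite !compmA; congr (_ ∘ _).
exact/esym/(naturality (colax_nt H e) psi).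
Qed.

(** The unit axiom gives this at level 0, and compatibility with the order
    carries it to level [e]. *)
Lemma colax_map_unit (R : realType) (C D : category) (T : flow R C)
    (S : flow R D) (H : colax_equivariant T S) (e : {nonneg R}) (a : C) :
  colax_map H (flow_le T (nneg_ge0 e) a ∘ flow_unit T a)
  = flow_le S (nneg_ge0 e) (H a) ∘ flow_unit S (H a).
Proof. by rewrite /colax_map fmorM compmA colax_le -compmA colax_unit. Qed.

Lemma weakly_interleaved_colax (R : realType) (C D : category) (T : flow R C)
    (S : flow R D) (H : colax_equivariant T S) (e : {nonneg R}) (a b : C) :
  weakly_interleaved T e a b -> weakly_interleaved S e (H a) (H b).
Proof.
move=> [phi [psi [phiK psiK]]].
exists (colax_map H phi), (colax_map H psi).
by split; rewrite colax_map_comp (phiK, psiK) colax_map_unit.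
Qed.

Theorem theorem4p2 (R : realType) (C D : category) (T : flow R C) (S : flow R D)
  (H : colax_equivariant T S) (a b : C) :
  (interleaving_dist S (H a) (H b) <= interleaving_dist T a b)%E.
Proof.
apply: ereal_inf_le_tmp; apply: image_subset => e.
exact: weakly_interleaved_colax.
Qed.
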